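(* Let $a,b\ge1$ and $n\ge2$ be integers. Then $$i(\mathbf C_n^{a,b},t)=\frac1nF(na,nb,0,t)-\frac1nF(a,b,0,t)^n+F(a,b,0,t)\,i(\mathbf C_{n-1}^{a,b},t)+\sum_{\sigma\in\Gamma_n}(-1)^{\ell(\sigma)}\frac{d(\sigma)}{\ell(\sigma)}\prod_{j=1}^{\ell(\sigma)}i(\overline{\mathbf C}_{\sigma_j}^{a,b},t),$$ where for $p\ge2$, $i(\overline{\mathbf C}_p^{a,b},t)=i(\mathbf C_p^{a,b},t)-F(a,b,0,t)\,i(\mathbf C_{p-1}^{a,b},t)$, and $i(\mathbf C_1^{a,b},t)=F(a,b,0,t)$.
   Context: For $S,T\subseteq[N]$, write $T\le S$ if $|T|=|S|$ and the $i$-th smallest element of $T$ is at most the $i$-th smallest element of $S$ for each $i$. The Schubert matroid $\mathrm{SM}_N(S)$ is the matroid on $[N]$ with bases $\{T\subseteq[N]:T\le S\}$. $i(M,t)$ denotes the Ehrhart polynomial of the matroid polytope $\mathrm{conv}\{\sum_{b\in B}e_b: B \text{ a basis of } M\}$, i.e. the number of lattice points in its $t$-th dilate. The $(a,b)$-Catalan matroid $\mathbf C_n^{a,b}$ is the Schubert matroid $\mathrm{SM}_{(a+b)n}(S)$ where $S$ has indicator vector $(0^a,1^b,0^a,1^b,\dots,0^a,1^b)$ with $n$ repetitions of the block $(0^a,1^b)$ ($x^p$ = $p$ consecutive copies of $x$). For integers $a,b\ge0$ with $a+b\ge1$, $c\in\mathbb Z$, $t\ge0$: $F(a,b,c,t)=\sum_{j=0}^{a+b}(-1)^j\binom{a+b}{j}\binom{(t+1)(b-j)+a+c-1}{a+b-1}$,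 with $\binom00=1$ and $\binom NK=0$ if $K<0$ or $N<K$. A composition $\sigma=(\sigma_1,\dots,\sigma_s)$ of $n$ is a sequence of integers with sum $n$; $\ell(\sigma)=s$. Two compositions are equivalent if one is obtained from the other by a cyclic shift $(\sigma_j,\dots,\sigma_s,\sigma_1,\dots,\sigma_{j-1})$; $d(\sigma)$ is the number of compositions in the equivalence class of $\sigma$. $\Gamma_n$ is a set containing exactly one representative of each equivalence class of compositions $\sigma$ of $n$ with $\ell(\sigma)\ge2$ and all parts $\sigma_i\ge2$. *)

(* Defs.v *)
From HB Require Import structures.
From mathcomp Require Import all_boot all_order all_algebra.
From mathcomp Require Import boolp.
Set Implicit Arguments. Unset Strict Implicit. Unset Printing Implicit Defensive.
Import Order.TTheory GRing.Theory Num.Theory.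
Local Open Scope ring_scope.

(* [N] = {1,..,N} is modelled by 'I_N = {0,..,N-1} (order-preserving shift). *)

Definition sorted_elems (N : nat) (T : {set 'I_N}) : seq 'I_N :=
  sort (fun i j : 'I_N => (i <= j)%N) (enum T).

Definition gale_le (N : nat) (T S : {set 'I_N}) : bool :=
  (#|T| == #|S|)%N &&
  all2 (fun i j : 'I_N => (i <= j)%N) (sorted_elems T) (sorted_elems S).

Definition schubert_bases (N : nat) (S : {set 'I_N}) : {set {set 'I_N}} :=
  [set T | gale_le T S].

(* x lies in the t-th dilate of the matroid polytope conv{ e_B : B in bases }:
   x = sum_B lam_B e_B with lam_B >= 0 and sum_B lam_B = t. *)
Definition in_dilate (N : nat) (bases : {set {set 'I_N}}) (t : nat)
    (x : 'I_N -> nat) : Prop :=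
  exists lam : {set 'I_N} -> rat,
    (forall T, 0 <= lam T) /\
    (forall T, T \notin bases -> lam T = 0) /\
    \sum_(T : {set 'I_N}) lam T = t%:R /\
    (forall i, (x i)%:R = \sum_(T in bases) lam T * (i \in T)%:R).

(* i(M,t): number of lattice points of the t-th dilate of the matroid polytope.
   Every lattice point of t*P has coordinates in {0,..,t}, so we count
   x in {0,..,t}^N. *)
Definition ehrhart (N : nat) (bases : {set {set 'I_N}}) (t : nat) : nat :=
  #|[set x : {ffun 'I_N -> 'I_t.+1} | `[< in_dilate bases t (fun i => val (x i)) >] ]|.

(* The (a,b)-Catalan matroid C_n^{a,b} = SM_{(a+b)n}(S), S with indicator
   vector (0^a 1^b)^n : position k (0-indexed) is in S iff k mod (a+b) >= a. *)
Definition catalan_set (a b n : nat) : {set 'I_((a + b) * n)} :=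
  [set k : 'I_((a + b) * n) | (a <= k %% (a + b))%N].

Definition ehrC (a b n t : nat) : nat :=
  ehrhart (schubert_bases (catalan_set a b n)) t.

Definition binz (M : int) (K : nat) : int :=
  match M with Posz m => ('C(m, K))%:Z | Negz _ => 0 end.

Definition Ffun (a b : nat) (c : int) (t : nat) : int :=
  \sum_(j < (a + b).+1)
     (-1) ^+ j * ('C(a + b, j))%:Z *
     binz ((t.+1)%:Z * (b%:Z - (j : nat)%:Z) + a%:Z + c - 1) (a + b).-1.

Definition ehrCbar (a b p t : nat) : rat :=
  (ehrC a b p t)%:R - (Ffun a b 0 t)%:~R * (ehrC a b p.-1 t)%:R.

Definition good_comp (n : nat) (s : seq nat) : bool :=
  [&& sumn s == n, (2 <= size s)%N & all (fun x => 2 <= x)%N s].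

Definition cyc_equiv (s u : seq nat) : bool :=
  has (fun k => rot k s == u) (iota 0 (size s)).

Definition dclass (s : seq nat) : nat :=
  size (undup [seq rot k s | k <- iota 0 (size s)]).

Definition is_Gamma (n : nat) (Gamma : seq (seq nat)) : Prop :=
  (forall s, s \in Gamma -> good_comp n s) /\
  (forall s, good_comp n s -> count (cyc_equiv s) Gamma = 1%N).

(* Main.v *)
(* The lattice points of the [t]-th dilate are the vectors with entries in
   [0..t] whose prefix sums dominate [t] times those of the indicator of [S].  For
   the Catalan matroid only block ends matter, so [i(C_n, t)] counts excursions of
   length [n] whose steps are block sums minus [t b], while [F(ka, kb, 0, t)] counts
   the bridges of length [k].  Spitzer's identity gives
   [sum_n i(C_n, t) x^n = exp (sum_k F(ka, kb, 0, t) x^k / k)].  Multiplying by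
   [1 - F(a, b, 0, t) x] and taking logarithms yields a sum over compositions with
   parts at least 2, which is grouped into classes under cyclic shift. *)
Require Import Defs.
From HB Require Import structures.
From mathcomp Require Import all_boot all_order all_algebra.
From mathcomp Require Import boolp zify ring.
Set Implicit Arguments. Unset Strict Implicit. Unset Printing Implicit Defensive.
Import Order.TTheory GRing.Theory Num.Theory.
Local Open Scope ring_scope.

(** * Lattice points of Schubert matroid polytopes *)

(** Turns the entrywise Gale comparison into inequalities between prefix counts. The threshold
    [(f y).+1] compares the heads; for [k <= f y] the sorted tail of [u] contributes nothing, so
    larger thresholds handle the tails. *)
Lemma all2_leq_count (T : eqType) (f : T -> nat) (s u : seq T) :
  sorted (fun i j => f i <= f j)%N s -> sorted (fun i j => f i <= f j)%N u ->
  size s = size u ->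
  all2 (fun i j => f i <= f j)%N s u <->
  forall k, (count (fun i => f i < k) u <= count (fun i => f i < k) s)%N.
Proof.
have tr : transitive (fun i j => f i <= f j)%N by move=> ? ? ?; apply: leq_trans.
elim: s u => [|x s IH] [|y u] //= ss su [szE].
have mx := order_path_min tr ss; have my := order_path_min tr su.
have {}IH := IH u (path_sorted ss) (path_sorted su) szE.
split=> [/andP[xy /IH H] k|H].
  by have := H k; case: ltnP => // yk; case: ltnP; lia.
apply/andP; split.
  have := H (f y).+1; rewrite ltnS leqnn; case: ltnP => // xy.
  have -> : count (fun i => f i < (f y).+1)%N s = 0%N; last by lia.
  apply/eqP; rewrite -leqn0 leqNgt -has_count; apply/negP => /hasP[z zs].
  by have /allP/(_ z zs) := mx; lia.
apply/IH => k; have := H k; case: (ltnP (f y) k) => [|yk _].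
  by case: (ltnP (f x) k); lia.
suff -> : count (fun i => f i < k)%N u = 0%N by [].
apply/eqP; rewrite -leqn0 leqNgt -has_count; apply/negP => /hasP[z zs].
by have /allP/(_ z zs) := my; lia.
Qed.

Definition psum (N : nat) (x : 'I_N -> nat) (k : nat) : nat :=
  \sum_(i < N | (i < k)%N) x i.

Lemma psum0 N (x : 'I_N -> nat) : psum x 0 = 0%N.
Proof. by rewrite /psum big_pred0. Qed.

Lemma psumS N (x : 'I_N -> nat) (i : 'I_N) : psum x i.+1 = (psum x i + x i)%N.
Proof.
rewrite /psum (bigD1 i) //= addnC; congr (_ + _)%N.
by apply: eq_bigl => j; rewrite ltnS ltn_neqAle andbC.
Qed.

Lemma psum_all N (x : 'I_N -> nat) : psum x N = (\sum_(i < N) x i)%N.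
Proof. by apply: eq_bigl => j; rewrite ltn_ord. Qed.

Lemma psum_ge N (x : 'I_N -> nat) k : (N <= k)%N -> psum x k = psum x N.
Proof. by move=> Nk; rewrite psum_all; apply: eq_bigl => i; rewrite (leq_trans _ Nk). Qed.

Lemma psum_card N (T : {set 'I_N}) : psum (fun i => (i \in T) : nat) N = #|T|.
Proof.
rewrite psum_all -sum1_card [RHS]big_mkcond /=.
by apply: eq_bigr => i _; case: (i \in T).
Qed.

Lemma psum_le N (x : 'I_N -> nat) (t j d : nat) :
  (forall i, x i <= t)%N -> (psum x (j + d) <= psum x j + t * d)%N.
Proof.
move=> xt; elim: d => [|d IH]; first by rewrite addn0 muln0 addn0.
rewrite addnS; case: (ltnP (j + d) N) => jd.
  by have := psumS x (Ordinal jd); have := xt (Ordinal jd) => /=; lia.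
have -> : psum x (j + d).+1 = psum x (j + d).
  by apply: eq_bigl => i; rewrite !(leq_trans (ltn_ord i)) // ltnW.
by rewrite mulnS; lia.
Qed.

Lemma count_sorted_elems N (T : {set 'I_N}) k :
  count (fun i : 'I_N => i < k)%N (sorted_elems T) = psum (fun i => (i \in T) : nat) k.
Proof.
rewrite /sorted_elems (permP (permEl (perm_sort _ _))).
rewrite /psum -sum1_count big_enum_cond /= big_mkcondr [RHS]big_mkcond big_mkcond /=.
by apply: eq_bigr => i _; case: (i \in T); case: ifP.
Qed.

Lemma gale_leP N (T S : {set 'I_N}) :
  gale_le T S <->
  #|T| = #|S| /\
  forall k, (psum (fun i => (i \in S) : nat) k <= psum (fun i => (i \in T) : nat) k)%N.
Proof.
have st (V : {set 'I_N}) : sorted (fun i j : 'I_N => (i <= j)%N) (sorted_elems V).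
  by apply: sort_sorted => i j; apply: leq_total.
have H : #|T| = #|S| -> size (sorted_elems T) = size (sorted_elems S).
  by rewrite !size_sort -!cardE.
split=> [/andP[/eqP e /(all2_leq_count (st _) (st _) (H e)) h]|[e h]].
  by split=> // k; rewrite -!count_sorted_elems.
rewrite /gale_le e eqxx /=; apply/(all2_leq_count (st _) (st _) (H e)) => k.
by rewrite !count_sorted_elems.
Qed.

(** Raising [X] by one shifts the window of numerators: the term [X %/ t] leaves and
    [(X + t) %/ t = X %/ t + 1] enters. *)
Lemma hermite t X : (0 < t)%N -> (\sum_(r < t) (X + r) %/ t = X)%N.
Proof.
move=> t0; elim: X => [|X IH].
  by rewrite big1 // => r _; rewrite add0n divn_small.
rewrite -[RHS]addn1 -{2}IH; case: t t0 {IH} => // t _.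
rewrite big_ord_recr [in RHS]big_ord_recl /=.
have -> : ((X.+1 + t) %/ t.+1 = X %/ t.+1 + 1)%N by rewrite addSnnS divnDr ?divnn.
rewrite addn0 addnA [(X %/ _ + _)%N]addnC; congr (_ + _ + _)%N.
by apply: eq_bigr => i _; rewrite addSnnS.
Qed.

(* Conversely, an integer point [x] with the right prefix sums is the sum of the [t]
   bases [B r], [0 <= r < t], formed by the jumps of
   [k |-> floor ((x_1 + .. + x_k + r) / t)]; Hermite's identity counts the jumps. *)
Lemma in_dilateP N (S : {set 'I_N}) t (x : 'I_N -> nat) :
  (forall i, x i <= t)%N ->
  in_dilate (schubert_bases S) t x <->
  (forall k, t * psum (fun i => (i \in S) : nat) k <= psum x k)%N /\
  (psum x N = t * #|S|)%N.
Proof.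
move=> xt; split.
  (* Prefix sums are linear in [x], and the indicator of every basis satisfies the required
     relations with factor 1; weights of total [t] scale them by [t]. *)
  case=> lam [lam0 [lamN [lamt lamx]]].
  have lamt' : \sum_(T in schubert_bases S) lam T = t%:R.
    by rewrite -lamt [RHS](bigID (mem (schubert_bases S))) /= [X in _ + X]big1 ?addr0.
  have E k : (psum x k)%:R =
      \sum_(T in schubert_bases S) lam T * (psum (fun i => (i \in T) : nat) k)%:R.
    rewrite natr_sum (eq_bigr _ (fun i _ => lamx i)) exchange_big /=.
    by apply: eq_bigr => T _; rewrite natr_sum mulr_sumr.
  split=> [k|].
    rewrite -(ler_nat rat) E natrM -lamt' mulr_suml; apply: ler_sum => T.
    rewrite inE => /gale_leP[_ h]; apply: ler_wpM2l => //.
    by rewrite ler_nat.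
  apply/eqP; rewrite -(eqr_nat rat) E natrM -lamt' mulr_suml; apply/eqP.
  by apply: eq_bigr => T; rewrite inE => /gale_leP[<- _]; rewrite psum_card.
case=> h1 h2.
have [t0|t0] := posnP t.
  exists (fun=> 0); split=> //; split=> //; split.
    by rewrite big1 // t0.
  by move=> i; have := xt i; rewrite t0 leqn0 => /eqP->; rewrite big1 // => T _; rewrite mul0r.
pose Q r k := ((psum x k + r) %/ t)%N.
pose B (r : 'I_t) := [set i : 'I_N | (Q r i < Q r i.+1)%N].
(* Since [x i <= t], each quotient rises by at most 1, so [Q r] is the prefix-sum function of the
   indicator of [B r]. *)
have QS r (i : 'I_N) : Q r i.+1 = (Q r i + (i \in [set i : 'I_N | (Q r i < Q r i.+1)%N]))%N.
  rewrite inE; have : (Q r i <= Q r i.+1 <= Q r i + 1)%N; last by case: ltnP; lia.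
  rewrite /Q psumS leq_div2r /=; last by lia.
  have -> : (((psum x i + r) %/ t + 1) = (psum x i + r + t) %/ t)%N.
    by rewrite [RHS]divnDr ?divnn ?t0 ?dvdnn.
  by rewrite leq_div2r //; have := xt i; lia.
have pB (r : 'I_t) k : (k <= N)%N -> psum (fun i => (i \in B r) : nat) k = Q r k.
  elim: k => [|k IH] kN; first by rewrite psum0 /Q psum0 add0n divn_small.
  by rewrite (psumS _ (Ordinal kN)) /= IH 1?ltnW // (QS r (Ordinal kN)).
have Bb r : B r \in schubert_bases S.
  have QN : Q r N = #|S| by rewrite /Q h2 mulnC divnMDl // divn_small ?addn0.
  rewrite inE; apply/gale_leP; split; first by rewrite -QN -(pB r N) // psum_card.
  have H k : (k <= N)%N -> (psum (fun i => (i \in S) : nat) k <= psum (fun i => (i \in B r) : nat) k)%N.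
    move=> kN; rewrite pB // /Q leq_divRL //; have := h1 k; lia.
  move=> k; case: (leqP k N) => [/H //|/ltnW kN].
  by rewrite psum_ge // [leqRHS]psum_ge // H.
(* The weight of [T] is its multiplicity among the [B r], which may coincide. *)
exists (fun T => \sum_(r < t) (T == B r)%:R); split; first by move=> T; apply: sumr_ge0.
split.
  move=> T Tn; rewrite big1 // => r _; case: eqP => // TE.
  by rewrite TE Bb in Tn.
split.
  rewrite exchange_big /= (eq_bigr (fun=> 1)) ?sumr_const ?card_ord // => r _.
  by rewrite (bigD1 (B r)) //= eqxx big1 ?addr0 // => T /negPf->.
move=> i.
have xE : x i = (\sum_(r < t) (i \in B r))%N.
  apply: (@addnI (psum x i)); rewrite -psumS -(hermite (psum x i.+1) t0) -{1}(hermite (psum x i) t0).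
  by rewrite -big_split /=; apply: eq_bigr => r _; rewrite -/(Q r i) -QS.
rewrite xE natr_sum; under [RHS]eq_bigr do rewrite mulr_suml.
rewrite exchange_big /=; apply: eq_bigr => r _.
rewrite (bigD1 (B r) (Bb r)) /= eqxx mul1r big1 ?addr0 // => T /andP[_ /negPf->].
by rewrite mul0r.
Qed.

(** * Spitzer's identity *)

Section Cut.
Variable R : comNzRingType.
Implicit Types f g q : {poly R}.

Definition cut (c : nat) f := drop_poly c f * 'X^c.

Lemma coef_cut c f i : (cut c f)`_i = if (c <= i)%N then f`_i else 0.
Proof. by rewrite coefMXn coef_drop_poly; case: leqP => // h; rewrite subnK. Qed.

Lemma cutD c f g : cut c (f + g) = cut c f + cut c g.
Proof. by apply/polyP => i; rewrite coefD !coef_cut coefD; case: ifP; rewrite ?addr0. Qed.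

Lemma cutB c f g : cut c (f - g) = cut c f - cut c g.
Proof. by apply/polyP => i; rewrite coefB !coef_cut coefB; case: ifP; rewrite ?subr0. Qed.

Lemma cut_sum c (I : finType) (F : I -> {poly R}) :
  cut c (\sum_i F i) = \sum_i cut c (F i).
Proof.
have c0 : cut c 0 = 0 by apply/polyP => i; rewrite coef_cut coef0 if_same.
exact: (big_morph _ (cutD c) c0).
Qed.

Lemma cutMXn c f : cut c (f * 'X^c) = f * 'X^c.
Proof. by apply/polyP => i; rewrite coef_cut coefMXn ltnNge; case: (c <= i)%N. Qed.

Lemma cutMl c f g : cut c (f * cut c g) = f * cut c g.
Proof. by rewrite /cut mulrA -/(cut c _) cutMXn. Qed.

Lemma cut_small c f : (size f <= c)%N -> cut c f = 0.
Proof.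
move=> h; apply/polyP => i; rewrite coef_cut coef0; case: leqP => // ci.
by rewrite nth_default // (leq_trans h).
Qed.

(* [cut] plays the role of the projection of Laurent polynomials onto nonnegative
   exponents, after a shift by [c]; it is a graded Rota-Baxter operator. *)
Lemma cut_rota_baxter i j f g :
  cut i f * cut j g =
  cut (i + j) (f * cut j g) + cut (i + j) (cut i f * g) - cut (i + j) (f * g).
Proof.
rewrite -cutD -cutB.
(* The discarded low parts have degrees below [i] and [j], so their product is killed by
   [cut (i + j)], while [cut i f * cut j g] is fixed by it. *)
have -> : f * cut j g + cut i f * g - f * g =
    cut i f * cut j g - (f - cut i f) * (g - cut j g) by ring.
have takeE c h : h - cut c h = take_poly c h.
  by rewrite -{1}(poly_take_drop c h) addrK.
rewrite cutB !takeE [X in _ - X]cut_small ?subr0; last first.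
  have := size_polyMleq (take_poly i f) (take_poly j g).
  by have := size_take_poly i f; have := size_take_poly j g; lia.
by rewrite /cut mulrACA -exprD -/(cut _ _) cutMXn.
Qed.

Lemma coef_cutM i j f g : (cut i f * cut j g)`_(i + j) = (cut i f)`_i * (cut j g)`_j.
Proof. by rewrite /cut mulrACA -exprD !coefMXn !ltnn !subnn coef0M. Qed.

(* Generating polynomial, by final height, of the walks with step polynomial [q]
   whose height after [k] steps is at least [tau k] for [0 < k <= n]. *)
Fixpoint walks q (tau : nat -> nat) (n : nat) : {poly R} :=
  if n is k.+1 then cut (tau n) (q * walks q tau k) else 1.

Lemma cut_walks q tau n : tau 0 = 0%N -> cut (tau n) (walks q tau n) = walks q tau n.
Proof.
move=> t0; case: n => [|n] /=; last by rewrite -[X in cut _ X]mul1r cutMl mul1r.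
by rewrite t0; apply/polyP => i; rewrite coef_cut leq0n.
Qed.

(* Rota-Baxter applied to each summand makes the sum telescope, up to [cut] of
   [q] times the same sum for [n - 1]. *)
Lemma spitzer q M n :
  n%:R * walks q (muln M) n =
  \sum_(k < n) cut (M * k.+1) (q ^+ k.+1) * walks q (muln M) (n - k.+1).
Proof.
set U := walks q (muln M).
elim: n => [|n IH]; first by rewrite big_ord0 mul0r.
pose f k := cut (M * n.+1) (q ^+ k.+1 * U (n - k)%N).
have step (k : 'I_n) : cut (M * k.+1) (q ^+ k.+1) * U (n - k)%N =
    cut (M * n.+1) (q * (cut (M * k.+1) (q ^+ k.+1) * U (n - k.+1)%N)) - (f k.+1 - f k).
  have nk : (n - k = (n - k.+1).+1)%N by have := ltn_ord k; lia.
  have E : (M * k.+1 + M * (n - k.+1).+1 = M * n.+1)%N by have := ltn_ord k; nia.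
  rewrite /f nk {1}/U /= -/U cut_rota_baxter E.
  have -> : cut (M * (n - k.+1).+1) (q * U (n - k.+1)%N) = U (n - k.+1).+1 by [].
  have -> : q ^+ k.+1 * (q * U (n - k.+1)%N) = q ^+ k.+2 * U (n - k.+1)%N.
    by rewrite mulrA -exprSr.
  rewrite [q ^+ k.+1 * U _]mulrC mulrCA; ring.
rewrite big_ord_recr /= subSS subnn.
rewrite (eq_bigr _ (fun k _ => step k)) sumrB -cut_sum -mulr_sumr -IH.
(* The last summand equals [f n] and cancels the end of the telescoped sum, leaving [f 0 = U n.+1];
   the inductive hypothesis supplies [n] further copies. *)
rewrite -(big_mkord xpredT (fun k => f k.+1 - f k)) telescope_sumr // /f subn0 subnn.
rewrite expr1 /U /= -/U !mulr1.
have -> : q * (n%:R * U n) = \sum_(i < n) q * U n.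
  by rewrite sumr_const card_ord mulrCA mulr_natl.
rewrite cut_sum sumr_const card_ord -[n.+1%:R]natr1 mulrDl mul1r mulr_natl.
by ring.
Qed.

(** The lowest admissible degree selects excursions on the left, and bridges followed by excursions
    on the right. This is the logarithmic-derivative form of the exponential identity. *)
Lemma spitzer_coef q M n :
  n%:R * (walks q (muln M) n)`_(M * n) =
  \sum_(k < n) (q ^+ k.+1)`_(M * k.+1) *
     (walks q (muln M) (n - k.+1))`_(M * (n - k.+1)).
Proof.
have -> : n%:R * (walks q (muln M) n)`_(M * n) = (n%:R * walks q (muln M) n)`_(M * n).
  by rewrite !mulr_natl coefMn.
rewrite spitzer coef_sum; apply: eq_bigr => k _.
have E : (M * n = M * k.+1 + M * (n - k.+1))%N by have := ltn_ord k; nia.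
rewrite -(@cut_walks q (muln M)) ?muln0 //.
by rewrite {1}E coef_cutM coef_cut leqnn.
Qed.

(** The threshold rises only at multiples of [m]. Inside a block the polynomial is already divisible
    by the current power of ['X], so [cut] does nothing and the factors [q] accumulate. *)
Lemma walks_block q m M n : (0 < m)%N ->
  walks q (fun k => M * (k %/ m))%N (m * n) = walks (q ^+ m) (muln M) n.
Proof.
move=> m0; pose tau k := (M * (k %/ m))%N; rewrite -/tau.
have H d k : (d < m)%N -> walks q tau (m * k + d) = q ^+ d * walks q tau (m * k).
  have tau0 : tau 0 = 0%N by rewrite /tau div0n muln0.
  have tauE e : (e < m)%N -> tau (m * k + e)%N = (M * k)%N.
    by move=> em; rewrite /tau [(m * k)%N]mulnC divnMDl // divn_small // addn0.
  elim: d => [|d IH] dm; first by rewrite addn0 mul1r.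
  rewrite addnS /= -addnS tauE // IH; last exact: ltnW.
  have := tauE 0%N m0; rewrite addn0 => E.
  have := @cut_walks q tau (m * k) tau0; rewrite E => <-.
  by rewrite mulrA -exprS cutMl.
elim: n => [|n IH] /=; first by rewrite muln0.
have -> : (m * n.+1 = (m * n + m.-1).+1)%N by rewrite mulnS; lia.
rewrite /= H ?prednK // -IH mulrA -exprS prednK //.
by rewrite /tau -addnS prednK // -mulnSr mulKn.
Qed.

End Cut.

(** * Lattice points as walks *)

Definition ffun_rcons (T : finType) n (f : {ffun 'I_n -> T}) (y : T) : {ffun 'I_n.+1 -> T} :=
  [ffun i => if unlift ord_max i is Some j then f j else y].

Lemma ffun_rcons_bij (T : finType) n :
  bijective (fun p : T * {ffun 'I_n -> T} => ffun_rcons p.2 p.1).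
Proof.
exists (fun g : {ffun 'I_n.+1 -> T} => (g ord_max, [ffun j : 'I_n => g (lift ord_max j)])).
  move=> [y f] /=; congr (_, _); first by rewrite ffunE unlift_none.
  by apply/ffunP => j; rewrite !ffunE liftK.
move=> g; apply/ffunP => i; rewrite ffunE /=.
by case: unliftP => [j|] ->; rewrite ?ffunE.
Qed.

Lemma psum_rcons t n (f : {ffun 'I_n -> 'I_t.+1}) y k : (k <= n)%N ->
  psum (fun i => val (ffun_rcons f y i)) k = psum (fun i => val (f i)) k.
Proof.
move=> kn; rewrite /psum big_mkcond big_ord_recr /= ltnNge kn addn0 [RHS]big_mkcond /=.
apply: eq_bigr => i _; case: ifP => // _.
rewrite ffunE; have -> : widen_ord (leqnSn n) i = lift ord_max i.
  by apply: val_inj; rewrite /= /bump leqNgt ltn_ord.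
by rewrite liftK.
Qed.

Definition above (tau : nat -> nat) N (x : 'I_N -> nat) : bool :=
  [forall k : 'I_N, (tau k.+1 <= psum x k.+1)%N].

Lemma walks_count (R : comNzRingType) t tau N j :
  (walks (\sum_(i < t.+1) 'X^i : {poly R}) tau N)`_j =
  (#|[set x : {ffun 'I_N -> 'I_t.+1} | above tau (fun i => val (x i)) &&
       (psum (fun i => val (x i)) N == j)]|)%:R.
Proof.
rewrite -sum1_card natr_sum; under eq_bigl do rewrite inE.
rewrite [RHS]big_mkcond /=.
elim: N j => [|N IH] j /=.
  have x0 : {ffun 'I_0 -> 'I_t.+1} by exact: [ffun=> ord0].
  rewrite (bigD1 x0) //= big1 ?addr0 => [|x]; last first.
    by case/eqP; apply/ffunP => -[].
  rewrite psum0 coef1 eq_sym; case: eqP => [_|]; last by rewrite andbF.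
  by rewrite andbT; case: ifP => // /forallP[] [].
rewrite coef_cut (reindex _ (onW_bij _ (ffun_rcons_bij _ _))) /=.
rewrite -(pair_bigA _ (fun y f => if above tau (fun i => val (ffun_rcons f y i)) &&
  (psum (fun i => val (ffun_rcons f y i)) N.+1 == j) then 1%:R else 0)) /=.
have sm (f : {ffun 'I_N -> 'I_t.+1}) (y : 'I_t.+1) : psum (fun i => val (ffun_rcons f y i)) N.+1 =
   (psum (fun i => val (f i)) N + y)%N.
  have := psumS (fun i => val (ffun_rcons f y i)) (@ord_max N).
  by rewrite /= [psum _ N]psum_rcons // /ffun_rcons ffunE unlift_none => ->.
have ab (f : {ffun 'I_N -> 'I_t.+1}) (y : 'I_t.+1) : above tau (fun i => val (ffun_rcons f y i)) =
   above tau (fun i => val (f i)) && (tau N.+1 <= psum (fun i => val (f i)) N + y)%N.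
  apply/forallP/andP => [h|[/forallP h l] k].
    split; last by have := h ord_max; rewrite /= sm.
    by apply/forallP => k; have := h (widen_ord (leqnSn N) k); rewrite /= psum_rcons.
  case: (ltnP k N) => kN; last first.
    have -> : nat_of_ord k = N by have := ltn_ord k; lia.
    by rewrite sm.
  by have := h (Ordinal kN); rewrite psum_rcons.
case: leqP => tj; last first.
  rewrite big1 // => y _; rewrite big1 // => f _; rewrite ab sm; case: ifP => //.
  by case/andP => /andP[_ ]; lia.
rewrite mulr_suml coef_sum; apply: eq_bigr => y _.
rewrite mulrC coefMXn; case: ltnP => yj.
  rewrite big1 // => f _; rewrite ab sm; case: ifP => //.
  by case/andP => /andP[_ _]; lia.
rewrite IH; apply: eq_bigr => f _; rewrite ab sm.
have -> : (psum (fun i => val (f i)) N + y == j)%N = (psum (fun i => val (f i)) N == j - y)%N.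
  by apply/eqP/eqP; lia.
rewrite -!andbA; congr (if _ && _ then _ else _).
case: eqP => [->|]; last by rewrite andbF.
by rewrite subnK // tj.
Qed.

(** Complete blocks give the first term; in the partial block the truncated subtraction stays 0
    along the zeros and then counts the ones. *)
Lemma psum_catalan a b n k : (0 < a + b)%N -> (k <= (a + b) * n)%N ->
  psum (fun i => (i \in catalan_set a b n) : nat) k =
  (b * (k %/ (a + b)) + (k %% (a + b) - a))%N.
Proof.
move=> m0; elim: k => [|k IH] kN; first by rewrite psum0 div0n mod0n muln0.
rewrite (psumS _ (Ordinal kN)) /= IH ?(ltnW kN) // inE /=.
have := ltn_pmod k m0; have := divn_eq k (a + b).
set d := (k %/ _)%N; set r := (k %% _)%N => kE rm.
case: (ltnP r.+1 (a + b)) => rm'.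
  have -> : (k.+1 %/ (a + b) = d)%N.
    by rewrite kE -addnS divnMDl // divn_small ?addn0.
  have -> : (k.+1 %% (a + b) = r.+1)%N.
    by rewrite kE -addnS modnMDl modn_small.
  by case: leqP; lia.
have kE' : (k.+1 = d.+1 * (a + b))%N by rewrite kE mulSn; lia.
rewrite kE' mulnK // modnMl mulnS.
by case: leqP; lia.
Qed.

(* Prefix inequalities inside a block [0^a 1^b] follow from the one at its end. *)
Lemma catalan_above a b n t (x : 'I_((a + b) * n) -> nat) :
  (0 < a + b)%N -> (forall i, x i <= t)%N ->
  (forall k, t * psum (fun i => (i \in catalan_set a b n) : nat) k <= psum x k)%N /\
    (psum x ((a + b) * n) = t * #|catalan_set a b n|)%N <->
  above (fun k => t * b * (k %/ (a + b)))%N x &&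
    (psum x ((a + b) * n) == t * b * n)%N.
Proof.
move=> m0 xt.
have card : #|catalan_set a b n| = (b * n)%N.
  by rewrite -psum_card psum_catalan // mulKn // modnMr sub0n addn0.
rewrite card mulnA; split.
  case=> h ->; rewrite eqxx andbT; apply/forallP => k.
  have := h k.+1; rewrite psum_catalan ?ltn_ord //.
  by apply: leq_trans; rewrite -mulnA leq_mul2l leq_addr orbT.
case/andP => /forallP h /eqP e; split=> //.
have {}h k : (k <= (a + b) * n)%N -> (t * b * (k %/ (a + b)) <= psum x k)%N.
  by case: k => [|k] kN; [rewrite div0n muln0 | exact: (h (Ordinal kN))].
suff H k : (k <= (a + b) * n)%N ->
    (t * psum (fun i => (i \in catalan_set a b n) : nat) k <= psum x k)%N.
  move=> k; case: (leqP k ((a + b) * n)) => [/H //|/ltnW kN].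
  by rewrite psum_ge // [leqRHS]psum_ge // H.
move=> kN; rewrite psum_catalan //.
have := divn_eq k (a + b); have := ltn_pmod k m0; have := h k kN.
set d := (k %/ _)%N; set r := (k %% _)%N => hk rm kE.
case: (leqP r a) => ra; first by have -> : (r - a = 0)%N; [lia | rewrite addn0 mulnA].
(* Beyond the zeros of its block, [k] is followed by [a + b - r] ones up to the block end. Each of
   these positions adds at most [t] to the prefix sum of [x], so the bound at the block end passes
   back to [k]. *)
have dn : (d < n)%N.
  rewrite -(ltn_pmul2l m0); apply: leq_trans kN; rewrite [in X in (_ < X)%N]kE; lia.
have := h ((a + b) * d.+1)%N; rewrite leq_pmul2l // mulKn // => /(_ dn) hd.
have := psum_le k (a + b - r) xt.
have -> : (k + (a + b - r) = (a + b) * d.+1)%N by rewrite {1}kE mulnS; lia.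
move=> hp; have {hd hp} := leq_trans hd hp.
have -> : (t * b * d.+1 = t * (b * d + (r - a)) + t * (a + b - r))%N.
  by rewrite -mulnDr -mulnA mulnS; congr (_ * _)%N; lia.
by rewrite leq_add2r.
Qed.

Lemma ehrC_walks (R : comNzRingType) a b n t : (0 < a + b)%N ->
  (ehrC a b n t)%:R =
  (walks ((\sum_(i < t.+1) 'X^i) ^+ (a + b) : {poly R}) (muln (t * b)) n)`_(t * b * n).
Proof.
move=> m0; rewrite -walks_block // walks_count /ehrC /ehrhart; congr (_%:R).
apply: eq_card => x; rewrite !inE.
have xt i : (val (x i) <= t)%N by exact: ltn_ord (x i).
apply/asboolP/idP.
  by move/(in_dilateP _ xt)/(catalan_above m0 xt).
by move/(catalan_above m0 xt)/(in_dilateP _ xt).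
Qed.

(** * Power series modulo X^N *)

Section TruncatedEquality.
Variable R : comNzRingType.
Implicit Types p q : {poly R}.

Definition eqm N p q := forall i, (i < N)%N -> p`_i = q`_i.

Lemma eqm_trans N p q r : eqm N p q -> eqm N q r -> eqm N p r.
Proof. by move=> h h' i iN; rewrite h // h'. Qed.

Lemma eqm_sym N p q : eqm N p q -> eqm N q p.
Proof. by move=> h i iN; rewrite h. Qed.

Lemma eqmB N p p' q q' : eqm N p p' -> eqm N q q' -> eqm N (p - q) (p' - q').
Proof. by move=> h h' i iN; rewrite !coefB h // h'. Qed.

Lemma eqmMl N r p q : eqm N p q -> eqm N (r * p) (r * q).
Proof.
move=> h i iN; rewrite !coefM; apply: eq_bigr => j _; rewrite h //.
by apply: leq_ltn_trans iN; apply: leq_subr.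
Qed.

Lemma eqmMr N r p q : eqm N p q -> eqm N (p * r) (q * r).
Proof. by rewrite ![_ * r]mulrC; apply: eqmMl. Qed.

Lemma eqmW N M p q : (M <= N)%N -> eqm N p q -> eqm M p q.
Proof. by move=> h e i iM; rewrite e // (leq_trans iM). Qed.

Lemma eqm_deriv N p q : eqm N.+1 p q -> eqm N p^`() q^`().
Proof. by move=> h i iN; rewrite !coef_deriv h. Qed.

Lemma eqm_geom N (F : R) :
  eqm N ((1 - F *: 'X) * \poly_(k < N) F ^+ k) 1.
Proof.
move=> i iN; rewrite mulrBl mul1r -scalerAl coefB coefZ coefXM !coef_poly iN coef1.
case: i iN => [|i] iN /=; first by rewrite mulr0 subr0 expr0.
by rewrite (ltnW iN) exprS subrr.
Qed.

(** Truncated expansion of the inverse of [(1 - 'X) ^+ m.+1]: by Pascal's rule one factor [1 - 'X]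
    lowers [m] by one. *)
Lemma eqm_negbin N m :
  eqm N ((1 - 'X) ^+ m.+1 * \poly_(i < N) ('C(i + m, m))%:R) 1.
Proof.
elim: m => [|m IH].
  have -> : \poly_(i < N) ('C(i + 0, 0))%:R = \poly_(i < N) (1 : R) ^+ i.
    by apply/polyP => i; rewrite !coef_poly bin0 expr1n.
  by rewrite expr1 -['X]scale1r; apply: eqm_geom.
apply: eqm_trans IH; rewrite exprSr -mulrA; apply: eqmMl => i iN.
rewrite mulrBl mul1r coefB coefXM !coef_poly iN.
case: i iN => [|i] iN /=; first by rewrite subr0 !add0n !binn.
by rewrite (ltnW iN) addSn binS natrD addrAC subrr add0r addSnnS.
Qed.

End TruncatedEquality.

(** Write the power of [1 + 'X + .. + 'X^t] as [(1 - 'X^(t.+1)) ^+ (a + b)] times the inverse of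
    [(1 - 'X) ^+ (a + b)]; expanding the first factor gives the alternating sum. *)
Lemma Ffun_coef (R : comNzRingType) a b t : (0 < a + b)%N ->
  (Ffun a b 0 t)%:~R = ((\sum_(i < t.+1) 'X^i) ^+ (a + b) : {poly R})`_(t * b).
Proof.
move=> m0; set m := (a + b).-1; have mE : (a + b = m.+1)%N by rewrite prednK.
set T := \poly_(i < (t * b).+1) ('C(i + m, m))%:R : {poly R}.
have E : (\sum_(i < t.+1) 'X^i : {poly R}) * (1 - 'X) = 1 - 'X^(t.+1).
  by rewrite mulrC -[1 - 'X]opprB mulNr -subrX1 opprB.
have := eqmMl ((\sum_(i < t.+1) 'X^i) ^+ (a + b)) (@eqm_negbin R (t * b).+1 m).
rewrite mulr1 mulrA {1}mE -exprMn E => <- //.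
rewrite exprBn mulr_suml coef_sum /Ffun mE rmorph_sum /=; apply: eq_bigr => j _.
rewrite expr1n mulr1 -mulrnAl [in RHS]mulrAC -exprM coefMXn.
have -> : (-1) ^+ j *+ 'C(m.+1, j) * T = ((-1) ^+ j *+ 'C(m.+1, j)) *: T.
  by rewrite -mul_polyC polyCMn rmorphXn /= polyCN.
rewrite coefZ coef_poly !rmorphM rmorphXn /= rmorphN1 -pmulrn -mulr_natr.
(* If [t * b < t.+1 * j], the upper argument of [binz] is below [m]: either negative, where [binz]
   is 0 by convention, or too small for the binomial. *)
case: ltnP => jt.
  rewrite [X in _ * X%:~R](_ : _ = 0) ?mulr0 //.
  case E1: (_ - 1) => [k|k] //=; rewrite bin_small //; nia.
rewrite ltnS leq_subr; congr (_ * _).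
have -> : t.+1%:Z * (b%:Z - (j : nat)%:Z) + a%:Z + 0 - 1 = (t * b - t.+1 * j + m)%N by nia.
by [].
Qed.

(* Coefficients of [log (1 + P)], where [G = P' / (1 + P)]. *)
Lemma log_coef (P G : {poly rat}) n : (0 < n)%N -> P`_0 = 0 ->
  eqm n P^`() (G * (1 + P)) ->
  G`_n.-1 = n%:R * \sum_(k < n) (-1) ^+ k / (k.+1)%:R * (P ^+ k.+1)`_n.
Proof.
move=> n0 P0 h; pose Q := \sum_(k < n) (- P) ^+ k.
have PX : P = drop_poly 1 P * 'X.
  by apply/polyP => -[|i]; rewrite coefMX //= coef_drop_poly addn1.
(* As [P] has no constant term, its [n]-th power vanishes modulo ['X^n], so the geometric sum [Q]
   inverts [1 + P]. *)
have PQ : eqm n ((1 + P) * Q) 1.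
  have -> : (1 + P) * Q = 1 - (- P) ^+ n.
    by rewrite -[RHS]opprB subrX1 -mulNr opprB opprK.
  move=> i iN; rewrite coefB exprNn PX exprMn mulrA coefMXn iN.
  by rewrite subr0.
have -> : G`_n.-1 = (P^`() * Q)`_n.-1.
  have n1 : (n.-1 < n)%N by rewrite prednK.
  rewrite (eqmMr Q h) // -mulrA (eqmMl G PQ) // mulr1 //.
rewrite mulr_sumr coef_sum mulr_sumr; apply: eq_bigr => k _.
have k0 : (k.+1)%:R != 0 :> rat by rewrite pnatr_eq0.
have := coef_deriv (P ^+ k.+1) n.-1; rewrite prednK // deriv_exp /= coefMn.
rewrite -[LHS]mulr_natl -[RHS]mulr_natl => /(canRL (mulKf k0)) H.
have -> : P^`() * (- P) ^+ k = ((-1) ^+ k)%:P * (P^`() * P ^+ k).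
  by rewrite mulrCA polyC_exp polyCN [in LHS]exprNn.
rewrite coefCM H; move: (_^-1) => c; ring.
Qed.

(** * Compositions up to cyclic shift *)

Fixpoint comps (k n : nat) : seq (seq nat) :=
  if k is k'.+1 then [seq p :: s | p <- iota 2 n.-1, s <- comps k' (n - p)%N]
  else if n == 0%N then [:: [::]] else [::].

Lemma mem_comps k n s :
  (s \in comps k n) = [&& sumn s == n, size s == k & all (leq 2) s].
Proof.
elim: k n s => [|k IH] n s.
  by case: s => [|p s] /=; case: eqP => [->|]; rewrite ?inE ?andbF //=; case: n.
apply/allpairsPdep/idP => /=.
  case=> p [u [+ + ->]]; rewrite mem_iota IH /= => pn /and3P[/eqP e /eqP -> ->].
  by rewrite eqxx e !andbT; lia.
case: s => [|p s] /=; first by rewrite andbF.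
case/and3P=> /eqP <- sz /andP[p2 al]; exists p, s; split=> //.
  by rewrite mem_iota; lia.
by rewrite IH addKn eqxx al andbT -eqSS.
Qed.

Lemma uniq_comps k n : uniq (comps k n).
Proof.
elim: k n => [|k IH] n /=; first by case: ifP.
apply: allpairs_uniq_dep => [|p _|[p u] [q v] _ _ /= [-> ->]] //.
exact: iota_uniq.
Qed.

(** Expanding the power chooses one degree per factor; the vanishing of the two lowest coefficients
    removes the parts 0 and 1. *)
Lemma coef_exp_comps (P : {poly rat}) k n : P`_0 = 0 -> P`_1 = 0 ->
  (P ^+ k)`_n = \sum_(s <- comps k n) \prod_(p <- s) P`_p.
Proof.
move=> P0 P1; elim: k n => [|k IH] n /=.
  by rewrite coef1; case: eqP => _; rewrite ?big_nil // big_seq1 big_nil.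
rewrite exprS coefM big_allpairs_dep /=.
rewrite -(big_mkord xpredT (fun i => P`_i * (P ^+ k)`_(n - i))).
have -> : iota 2 n.-1 = index_iota 2 n.+1 by rewrite /index_iota subSS subn1.
have E : forall i, P`_i * (P ^+ k)`_(n - i) =
    \sum_(s <- comps k (n - i)) \prod_(p <- i :: s) P`_p.
  by move=> i; rewrite IH mulr_sumr; apply: eq_bigr => s _; rewrite big_cons.
under [RHS]eq_bigr do rewrite -E.
case: n E => [|n] E; first by rewrite big_nat1 P0 mul0r big_geq.
by rewrite big_ltn // big_ltn // P0 P1 !mul0r !add0r.
Qed.

Lemma mem_rots (s u : seq nat) : (0 < size s)%N ->
  reflect (exists k, rot k s = u) (u \in [seq rot k s | k <- iota 0 (size s)]).
Proof.
move=> s0; apply: (iffP mapP) => [[k _ ->]|[k <-]]; first by exists k.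
case: (ltnP k (size s)) => ks; first by exists k; rewrite ?mem_iota.
by exists 0%N; rewrite ?mem_iota // rot_oversize // rot0.
Qed.

Lemma cyc_equivE s u : cyc_equiv s u = (u \in [seq rot k s | k <- iota 0 (size s)]).
Proof. by apply/hasP/mapP => -[k ki] => [/eqP <-|->]; exists k. Qed.

Lemma cyc_equiv_sym s u : (0 < size s)%N -> cyc_equiv s u = cyc_equiv u s.
Proof.
have half v w : (0 < size v)%N -> cyc_equiv v w -> cyc_equiv w v.
  rewrite !cyc_equivE => v0 /(mem_rots _ v0)[k <-].
  by apply/mem_rots; rewrite ?size_rot //; exists (size (rot k v) - k)%N; apply: rotK.
move=> s0; apply/idP/idP => [|h]; first exact: half.
by apply: half (h) => //; move: h; rewrite cyc_equivE; case: u.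
Qed.

Lemma cyc_equiv_rot s u : cyc_equiv s u -> exists k, u = rot k s.
Proof. by case/hasP => k _ /eqP <-; exists k. Qed.

Lemma good_comp_rot n k s : good_comp n (rot k s) = good_comp n s.
Proof.
have e : perm_eq (rot k s) s by rewrite perm_rot.
by rewrite /good_comp size_rot (perm_sumn e) (perm_all _ e).
Qed.

(* Double counting of the pairs of equivalent members of [Gamma] and [cs]. *)
Lemma sum_Gamma n Gamma (cs : seq (seq nat)) (g : seq nat -> rat) :
  is_Gamma n Gamma -> uniq cs -> cs =i good_comp n ->
  (forall k s, g (rot k s) = g s) ->
  \sum_(s <- Gamma) (dclass s)%:R * g s = \sum_(s <- cs) g s.
Proof.
move=> [Gg G1] csU csE gr.
(* Each good composition has exactly one equivalent representative in [Gamma], so the inserted inner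
   count is 1. *)
have -> : \sum_(u <- cs) g u = \sum_(u <- cs) \sum_(s <- Gamma) (cyc_equiv u s)%:R * g u.
  apply: eq_big_seq => u; rewrite csE => /G1 ug.
  rewrite -mulr_suml -natr_sum; have -> : (\sum_(s <- Gamma) cyc_equiv u s)%N = 1%N.
    by rewrite -[RHS]ug -sum1_count [RHS]big_mkcond; apply: eq_bigr => s _; case: cyc_equiv.
  by rewrite mul1r.
rewrite exchange_big /=; apply: eq_big_seq => s sG; have sg := Gg s sG.
have s0 : (0 < size s)%N by case/and3P: sg => _ /ltnW.
have -> : \sum_(u <- cs) (cyc_equiv u s)%:R * g u = \sum_(u <- cs) (cyc_equiv u s)%:R * g s.
  apply: eq_bigr => u _; case: (boolP (cyc_equiv u s)) => [|_]; last by rewrite !mul0r.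
  by case/cyc_equiv_rot => k ->; rewrite gr.
rewrite -mulr_suml -natr_sum; congr (_%:R * _).
have -> : (\sum_(u <- cs) cyc_equiv u s = size [seq u <- cs | cyc_equiv u s])%N.
  by rewrite size_filter -sum1_count [RHS]big_mkcond; apply: eq_bigr => u _; case: cyc_equiv.
apply/perm_size/uniq_perm; rewrite ?undup_uniq ?filter_uniq // => u.
rewrite mem_undup mem_filter csE -cyc_equivE cyc_equiv_sym //.
case: (boolP (cyc_equiv u s)) => //=; rewrite -cyc_equiv_sym // => /cyc_equiv_rot[k ->].
by rewrite -topredE /= good_comp_rot.
Qed.

(* With [E = exp (sum_k B_k X^k / k)], this expands the logarithm of
   [(1 - F X) E = 1 + P]. *)
Lemma log_recurrence (E B : nat -> rat) (F : rat) n :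
  (1 < n)%N -> E 0%N = 1 -> E 1%N = F ->
  (forall k, (0 < k)%N -> k%:R * E k = \sum_(j < k) B j.+1 * E (k - j.+1)%N) ->
  let P := \poly_(i < n.+1) (if (2 <= i)%N then E i - F * E i.-1 else 0) in
  B n - F ^+ n = n%:R * \sum_(k < n) (-1) ^+ k / (k.+1)%:R * (P ^+ k.+1)`_n.
Proof.
move=> n1 E0 E1 rec P; have n0 : (0 < n)%N by apply: ltnW.
pose Eh := \poly_(i < n.+1) E i; pose Bh := \poly_(k < n) B k.+1.
pose Fh := \poly_(k < n) F ^+ k.
have Eder : eqm n Eh^`() (Bh * Eh).
  move=> i iN; rewrite coef_deriv coefM coef_poly ltnS iN -mulr_natl rec //.
  apply: eq_bigr => j _; rewrite subSS !coef_poly.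
  have ji : (j <= i)%N by rewrite -ltnS.
  by rewrite (leq_ltn_trans ji iN) ltnS (leq_trans (leq_subr _ _) (ltnW iN)).
(* The linear coefficient of the product is [E 1 - F * E 0 = 0], which is why [P] starts in degree
   2. *)
have PE : eqm n.+1 (1 + P) ((1 - F *: 'X) * Eh).
  move=> i iN; rewrite mulrBl mul1r -scalerAl coefB coefZ coefXM coefD coef1 !coef_poly iN.
  case: i iN => [|[|i]] iN /=; rewrite ?add0r ?mulr0 ?subr0 ?addr0 ?E0 //.
    by rewrite E1 mulr1 subrr.
  by rewrite (ltnW iN).
(* Logarithmic derivatives add: [Bh] comes from [Eh], and [- F *: Fh] is the truncation of
   [- F / (1 - F X)]. *)
have key : eqm n P^`() ((Bh - F *: Fh) * (1 + P)).
  have -> : P^`() = (1 + P)^`() by rewrite derivD derivC add0r.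
  apply: eqm_trans (eqm_deriv PE) _.
  apply: eqm_trans (eqm_sym (eqmMl (Bh - F *: Fh) (eqmW (leqnSn n) PE))).
  have -> : ((1 - F *: 'X) * Eh)^`() = (1 - F *: 'X) * Eh^`() - F *: Eh.
    by rewrite derivM derivB derivC derivZ derivX sub0r addrC mulNr -scalerAl mul1r.
  have -> : (Bh - F *: Fh) * ((1 - F *: 'X) * Eh) =
      (1 - F *: 'X) * (Bh * Eh) - F%:P * (((1 - F *: 'X) * Fh) * Eh).
    by rewrite -!mul_polyC; ring.
  rewrite -[F *: Eh]mul_polyC; apply: eqmB; first exact: eqmMl.
  apply: eqmMl; rewrite -[X in eqm _ X]mul1r; apply: eqmMr.
  exact/eqm_sym/eqm_geom.
have P0 : P`_0 = 0 by rewrite coef_poly.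
rewrite -(log_coef n0 P0 key) coefB coefZ !coef_poly prednK // leqnn.
by rewrite -exprS prednK.
Qed.

Theorem theorem1p5 (a b n : nat) (Gamma : seq (seq nat)) :
  (1 <= a)%N -> (1 <= b)%N -> (2 <= n)%N -> is_Gamma n Gamma ->
  forall t : nat,
    ((ehrC a b 1 t)%:Z = Ffun a b 0 t) /\
    (ehrC a b n t)%:R =
      (n%:R)^-1 * (Ffun (n * a) (n * b) 0 t)%:~R
      - (n%:R)^-1 * ((Ffun a b 0 t)%:~R) ^+ n
      + (Ffun a b 0 t)%:~R * (ehrC a b n.-1 t)%:R
      + \sum_(s <- Gamma)
          (-1) ^+ (size s) * ((dclass s)%:R / (size s)%:R)
          * \prod_(p <- s) ehrCbar a b p t :> rat.
Proof.
move=> a1 b1 n2 GG t; have m0 : (0 < a + b)%N by lia.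
pose E k : rat := (ehrC a b k t)%:R.
pose B k : rat := (Ffun (k * a) (k * b) 0 t)%:~R.
set F : rat := (Ffun a b 0 t)%:~R.
pose q : {poly rat} := (\sum_(i < t.+1) 'X^i) ^+ (a + b).
have EW k : E k = (walks q (muln (t * b)) k)`_(t * b * k) by apply: ehrC_walks.
have BW k : B k.+1 = (q ^+ k.+1)`_(t * b * k.+1).
  rewrite /B Ffun_coef; last by lia.
  by rewrite -mulnDr mulnC exprM -mulnA [(b * _)%N]mulnC.
have rec k : (0 < k)%N -> k%:R * E k = \sum_(j < k) B j.+1 * E (k - j.+1)%N.
  move=> _; rewrite EW spitzer_coef; apply: eq_bigr => j _.
  by rewrite BW EW.
have E0 : E 0%N = 1 by rewrite EW muln0 coef1.
have BF : B 1%N = F by rewrite /B !mul1n.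
have E1 : E 1%N = F.
  by have := rec 1%N isT; rewrite mul1r big_ord1 subnn E0 mulr1 BF.
split.
  by apply/eqP; rewrite -(eqr_int rat) -[X in X == _]/(E 1%N) E1.
have := log_recurrence n2 E0 E1 rec.
set P := \poly_(i < _) _; move=> /= L.
have n0 : n%:R != 0 :> rat by rewrite pnatr_eq0; lia.
have Pp s p : (p \in s) -> (sumn s <= n)%N -> all (leq 2) s -> P`_p = ehrCbar a b p t.
  move=> ps sn /allP/(_ p ps) p2; rewrite coef_poly p2 ltnS.
  suff -> : (p <= n)%N by [].
  apply: leq_trans sn; rewrite sumnE (big_rem p) //=; exact: leq_addr.
have P0 : P`_0 = 0 by rewrite coef_poly.
have P1 : P`_1 = 0 by rewrite coef_poly ltnS (ltnW n2).
pose g (s : seq nat) := (-1) ^+ size s / (size s)%:R * \prod_(p <- s) ehrCbar a b p t.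
(* The lengths run over [2..n]: a good composition has at least two parts, and positive parts bound
   their number by [n]. *)
pose cs := flatten [seq comps k n | k <- iota 2 n.-1].
have csE : cs =i good_comp n.
  move=> s; rewrite -[RHS]topredE /=; apply/flatten_mapP/idP => [[k]|].
    rewrite mem_iota mem_comps /good_comp => kn /and3P[-> /eqP -> ->].
    by case/andP: kn => ->.
  case/and3P=> sn s2 al; exists (size s); last by rewrite mem_comps sn al eqxx.
  rewrite mem_iota s2 /= (_ : 2 + n.-1 = n.+1)%N ?ltnS; last by lia.
  rewrite -(eqP sn); move: al {sn s2}; elim: s => //= p s IH /andP[p2 /IH]; lia.
have csU : uniq cs.
  rewrite /cs; elim: (iota 2 n.-1) (iota_uniq 2 n.-1) => //= k ks IH /andP[kn /IH U].
  rewrite cat_uniq uniq_comps U andbT /=; apply/hasPn => s /flatten_mapP[k' k'k].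
  rewrite !mem_comps => /and3P[_ /eqP -> _]; rewrite andbC -andbA.
  by case: eqP => [k'E|]; [rewrite -k'E k'k in kn | rewrite ?andbF].
have gr k s : g (rot k s) = g s.
  by rewrite /g size_rot; congr (_ * _); apply: perm_big; rewrite perm_rot.
have -> : \sum_(s <- Gamma) (-1) ^+ size s * ((dclass s)%:R / (size s)%:R) *
    \prod_(p <- s) ehrCbar a b p t = \sum_(s <- Gamma) (dclass s)%:R * g s.
  by apply: eq_bigr => s _; rewrite /g; ring.
rewrite (sum_Gamma GG csU csE gr) big_flatten big_map /=.
have -> : \sum_(k <- iota 2 n.-1) \sum_(s <- comps k n) g s =
    \sum_(2 <= k < n.+1) (-1) ^+ k / k%:R * (P ^+ k)`_n.
  rewrite /index_iota subSS subn1; apply: eq_bigr => k _.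
  rewrite coef_exp_comps // mulr_sumr; apply: eq_big_seq => s.
  rewrite mem_comps => /and3P[/eqP sn /eqP sk al]; rewrite /g sk; congr (_ * _).
  by apply: eq_big_seq => p ps; rewrite (Pp s) // sn.
have Pn : P`_n = E n - F * E n.-1 by rewrite coef_poly leqnn n2.
move: L; rewrite -(big_mkord xpredT (fun k => (-1) ^+ k / k.+1%:R * (P ^+ k.+1)`_n)).
(* The term [k = 0] is the one-part composition and equals [E n - F * E n.-1]: it carries the
   unknown [E n]. The remaining terms are the sum over [Gamma], up to sign. *)
rewrite big_ltn ?(ltnW n2) // expr0 expr1 Pn divr1 mul1r.
have -> : \sum_(2 <= k < n.+1) (-1) ^+ k / k%:R * (P ^+ k)`_n =
    - \sum_(1 <= k < n) (-1) ^+ k / k.+1%:R * (P ^+ k.+1)`_n.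
  rewrite big_add1 -sumrN /=; apply: eq_bigr => k _.
  by rewrite exprS mulN1r !mulNr.
move: (\sum_(1 <= k < n) _) => S L.
rewrite -mulrBr -/(B n) L mulKf // -/(E n) -/(E n.-1); ring.
Qed.
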